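(* Let $V$ be an $n$-dimensional real vector space and let $\psi:TV\to V\times\mathbb{R}^n$ be the bundle trivialization of the tangent bundle $TV$. Then $\psi$ is a linear isomorphism, where $V\times\mathbb{R}^n$ carries its usual (product) vector space structure and $TV$ carries the vector space structure with sum $\oplus$ and scalar multiplication $\bullet$.
   Context: Vector space structure on $TV$: for $X\in T_xV$, $Y\in T_yV$, $\lambda\in\mathbb{R}$, set $X\oplus Y=(T\tau_y)X+(T\tau_x)Y\in T_{x+y}V$ and $\lambda\bullet X=(T\sigma_\lambda)X\in T_{\lambda x}V$, where $\tau_x:V\to V$ is translation by $x$, $\sigma_\lambda:V\to V$ is multiplication by $\lambda$, and $T$ denotes the tangent map (differential). Bundle trivialization: fix a linear isomorphism $\xi:V\to\mathbb{R}^n$ (coordinates with respect to a fixed basis of $V$), with global linear coordinate functions $x_i=u_i\circ\xi$ on $V$, where $u_i$ are the standard coordinate functions on $\mathbb{R}^n$. With $e_1,\dots,e_n$ the standard basis of $\mathbb{R}^n$, $\psi(v)=(p,\sum_i v[x_i]e_i)$ for $v\in T_pV$. *)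

(* Defs.v *)
From HB Require Import structures.
From mathcomp Require Import all_boot all_order all_algebra.
From mathcomp Require Import all_classical all_reals all_analysis.

Set Implicit Arguments.
Unset Strict Implicit.
Unset Printing Implicit Defensive.

Import Order.TTheory GRing.Theory Num.Theory.
Import numFieldNormedType.Exports.
Import VectorInternalTheory.

Local Open Scope classical_set_scope.
Local Open Scope ring_scope.

Section SmoothCoordinates.
Context {R : realType} {m : nat}.
Implicit Types f g : 'rV[R]_m -> R.

(* All partial derivatives of order at most k exist and are continuous. *)
Fixpoint Cdiff (k : nat) (f : 'rV[R]_m -> R) : Prop :=
  continuous f /\
  if k is k'.+1 then
    forall j : 'I_m, (forall x, derivable f x (delta_mx 0 j)) /\
                     Cdiff k' ('D_(delta_mx 0 j) f)
  else True.

Lemma Cdiff_cont k f : Cdiff k f -> continuous f.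
Proof. by case: k => [|k] []. Qed.

Lemma CdiffW k f : Cdiff k.+1 f -> Cdiff k f.
Proof.
elim: k f => [|k IHk] f; first by case.
by case=> cf Hf; split=> // j; have [df /IHk] := Hf j.
Qed.

Lemma Cdiff_cst k (c : R) : Cdiff k (cst c).
Proof.
elim: k c => [|k IHk] c; first by split=> // x; exact: cst_continuous.
split=> [x|j]; first exact: cst_continuous.
split=> [x|]; first exact: derivable_cst.
suff -> : 'D_(delta_mx 0 j) (cst c : 'rV[R]_m -> R) = cst 0 by exact: IHk.
by apply/funext => x; rewrite derive_cst.
Qed.

Lemma CdiffD k f g : Cdiff k f -> Cdiff k g -> Cdiff k (f + g).
Proof.
elim: k f g => [|k IHk] f g [cf Hf] [cg Hg].
  by split=> // x; apply: continuousD; [exact: cf|exact: cg].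
split=> [x|j]; first by apply: continuousD; [exact: cf|exact: cg].
have [df Cf] := Hf j; have [dg Cg] := Hg j.
split=> [x|]; first exact: derivableD.
suff -> : 'D_(delta_mx 0 j) (f + g) =
          'D_(delta_mx 0 j) f + 'D_(delta_mx 0 j) g by exact: IHk.
by apply/funext => x; rewrite deriveD.
Qed.

Lemma CdiffM k f g : Cdiff k f -> Cdiff k g -> Cdiff k (f * g).
Proof.
elim: k f g => [|k IHk] f g.
  by move=> [cf _] [cg _]; split=> // x; apply: continuousM; [exact: cf|exact: cg].
move=> Cf Cg; have [cf Hf] := Cf; have [cg Hg] := Cg.
split=> [x|j]; first by apply: continuousM; [exact: cf|exact: cg].
have [df Cdf] := Hf j; have [dg Cdg] := Hg j.
split=> [x|]; first exact: derivableM.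
suff -> : 'D_(delta_mx 0 j) (f * g) =
          f * 'D_(delta_mx 0 j) g + g * 'D_(delta_mx 0 j) f.
  by apply: CdiffD; apply: IHk => //; exact: CdiffW.
by apply/funext => x; rewrite deriveM.
Qed.

Lemma is_derive_affine f (a : R) (b x v : 'rV[R]_m) :
  derivable f (a *: x + b) v ->
  is_derive x v (fun y => f (a *: y + b)) (a * 'D_v f (a *: x + b)).
Proof.
move=> df; set y := a *: x + b in df *.
pose g (h : R) := f (h *: v + y).
have dg : is_derive (0 : R) (1 : R) g ('D_v f y).
  have e : (fun h : R => h^-1 *: ((g \o shift 0) (h *: (1 : R)) - g 0)) =
           (fun h : R => h^-1 *: ((f \o shift y) (h *: v) - f y)).
    apply/funext => h; rewrite /g /= addr0 scale0r add0r.
    by rewrite [h *: _]mulr1.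
  split; first by rewrite /derivable e.
  by rewrite /derive e.
have dm : is_derive (0 : R) (1 : R) (fun h : R => a * h) a.
  have -> : (fun h : R => a * h) = a \*: (id : R -> R) by [].
  by apply: is_derive_eq; rewrite [_ *: _]mulr1.
have dga : is_derive (a * 0 : R) (1 : R) g ('D_v f y) by rewrite mulr0.
have dc : is_derive (0 : R) (1 : R) (g \o (fun h : R => a * h)) (a * 'D_v f y).
  have := is_derive1_comp (f := g) (g := fun h : R => a * h).
  by rewrite mulrC => /(_ _ _ _ _); apply.
have e : (fun h : R => h^-1 *: (((fun z => f (a *: z + b)) \o shift x) (h *: v)
             - f (a *: x + b))) =
   (fun h : R => h^-1 *: (((g \o (fun h : R => a * h)) \o shift 0) (h *: (1 : R))
             - (g \o (fun h : R => a * h)) 0)).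
  apply/funext => h; rewrite /g /= addr0 mulr0 scale0r add0r.
  have -> : h *: (1 : R) = h by exact: mulr1.
  by rewrite [a *: (_ + x)]scalerDr [a *: (h *: v)]scalerA addrA.
case: dc => dc1 dc2; split; first by rewrite /derivable e; exact: dc1.
by rewrite /derive e; exact: dc2.
Qed.

Lemma Cdiff_affine k f (a : R) (b : 'rV[R]_m) :
  Cdiff k f -> Cdiff k (fun x => f (a *: x + b)).
Proof.
have caff : continuous (fun x : 'rV[R]_m => a *: x + b).
  move=> x; apply: continuousD; last exact: cst_continuous.
  exact: scaler_continuous.
have ccomp (h : 'rV[R]_m -> R) :
    continuous h -> continuous (fun x : 'rV[R]_m => h (a *: x + b)).
  by move=> ch x; apply: continuous_comp; [exact: caff|exact: ch].
elim: k f => [|k IHk] f [cf Hf]; split=> //; try exact: ccomp.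
move=> j; have [df Cdf] := Hf j.
have d x := is_derive_affine (df (a *: x + b)).
split=> [x|]; first by case: (d x).
have -> : 'D_(delta_mx 0 j) (fun x => f (a *: x + b)) =
  cst a * (fun x => 'D_(delta_mx 0 j) f (a *: x + b)).
  by apply/funext => x; have [_ ->] := d x.
exact: (CdiffM (Cdiff_cst k a) (IHk _ Cdf)).
Qed.

Lemma Cdiff_linear k (l : {scalar 'rV[R]_m}) : Cdiff k l.
Proof.
pose l' : 'rV[R]_m -> R := fun x => \sum_j x 0 j * l (delta_mx 0 j).
have lE : l = l' :> (_ -> _).
  apply/funext => x; rewrite [in LHS](row_sum_delta x) linear_sum.
  by apply: eq_bigr => j _; rewrite linearZ.
have cl : continuous l.
  rewrite lE /l' -(fct_sumE _ _ (fun j (x : 'rV[R]_m) => x 0 j * _)).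
  elim/big_rec: _ => [|j f _ cf] x; first exact: cst_continuous.
  apply: continuousD; last exact: cf.
  apply: continuousM; [exact: coord_continuous|exact: cst_continuous].
case: k => [|k]; split=> // j.
have d (x : 'rV[R]_m) : is_derive x (delta_mx 0 j) l (l (delta_mx 0 j)).
  have c : (fun h : R => h^-1 *: ((l \o shift x) (h *: delta_mx 0 j) - l x))
      @ 0^' --> l (delta_mx 0 j).
    apply: cvg_near_cst; near=> h.
    have h0 : h != 0 by near: h; exact: nbhs_dnbhs_neq.
    have -> : (l \o shift x) (h *: delta_mx 0 j) = h * l (delta_mx 0 j) + l x.
      by rewrite -scalarP.
    by rewrite addrK; exact: mulKf.
  split; first by apply/cvg_ex; exists (l (delta_mx 0 j)).
  exact: cvg_lim c.
split=> [x|]; first by case: (d x).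
suff -> : 'D_(delta_mx 0 j) l = cst (l (delta_mx 0 j)) by exact: Cdiff_cst.
by apply/funext => x; case: (d x) => _ ->.
Unshelve. all: by end_near. Qed.

End SmoothCoordinates.

Section SmoothFunctions.
Context {R : realType} {V : vectType R}.

(* The standard smooth structure of a finite-dimensional vector space has a
   linear isomorphism with R^m as global chart; the class does not depend on
   which one, and r2v is the inverse of the one provided by vectType. *)
Definition smooth : {pred V -> R} :=
  mem [set f : V -> R | forall k, Cdiff k (f \o r2v)].

Lemma smoothE (f : V -> R) :
  (f \in smooth) = `[< forall k, Cdiff k (f \o r2v) >].
Proof. by []. Qed.

Lemma smooth_cst (c : R) : (cst c : V -> R) \in smooth.
Proof. by rewrite smoothE; apply/asboolP => k; exact: Cdiff_cst. Qed.

Lemma smoothD (f g : V -> R) :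
  f \in smooth -> g \in smooth -> f + g \in smooth.
Proof.
rewrite !smoothE => /asboolP Cf /asboolP Cg; apply/asboolP => k.
exact: (CdiffD (Cf k) (Cg k)).
Qed.

Lemma smoothM (f g : V -> R) :
  f \in smooth -> g \in smooth -> f * g \in smooth.
Proof.
rewrite !smoothE => /asboolP Cf /asboolP Cg; apply/asboolP => k.
exact: (CdiffM (Cf k) (Cg k)).
Qed.

Lemma smoothZ (a : R) (f : V -> R) : f \in smooth -> a *: f \in smooth.
Proof. by move=> Cf; exact: (smoothM (smooth_cst a) Cf). Qed.

Lemma smooth_subring_closed : subring_closed smooth.
Proof.
split=> [|f g Cf Cg|f g]; [exact: smooth_cst| |exact: smoothM].
by rewrite -[- g]scaleN1r; apply: smoothD => //; exact: smoothZ.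
Qed.
HB.instance Definition _ :=
  GRing.isSubringClosed.Build (V -> R) smooth smooth_subring_closed.

Lemma smooth_scaler_closed : GRing.scaler_closed smooth.
Proof. exact: smoothZ. Qed.
HB.instance Definition _ :=
  GRing.isScaleClosed.Build R (V -> R) smooth smooth_scaler_closed.

End SmoothFunctions.

Record smoothFun (R : realType) (V : vectType R) := SmoothFun {
  smooth_fun :> V -> R;
  smooth_funP : smooth_fun \in smooth
}.

Section SmoothFunAlgebra.
Context (R : realType) (V : vectType R).
HB.instance Definition _ := [isSub for (@smooth_fun R V)].
HB.instance Definition _ := [Choice of smoothFun V by <:].
HB.instance Definition _ :=
  GRing.SubChoice_isSubComPzRing.Build (V -> R) smooth (smoothFun V)
    smooth_subring_closed.
HB.instance Definition _ := [SubZmodule_isSubLmodule of smoothFun V by <:].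
End SmoothFunAlgebra.

Section TangentBundle.
Context {R : realType} (V : vectType R).

(* A tangent vector at p is a derivation at p of the algebra of smooth
   functions; the total space TV is the type of pairs of a base point p and
   a derivation at p. *)
Record tangentBundle := TangentVector {
  foot : V;
  deriv_of :> {scalar smoothFun V};
  leibniz : forall f g : smoothFun V,
    deriv_of (f * g) = deriv_of f * g foot + f foot * deriv_of g
}.

End TangentBundle.

Section TangentMap.
Context {R : realType} {V : vectType R}.
Implicit Types X Y : tangentBundle V.

(* A map is smooth if it pulls smooth functions back to smooth functions. *)
Record smoothMap := SmoothMap {
  smooth_map :> V -> V;
  smooth_mapP : forall f : smoothFun V, (f \o smooth_map) \in smooth
}.

Definition pullback (phi : smoothMap) (f : smoothFun V) : smoothFun V :=
  SmoothFun (smooth_mapP phi f).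

Lemma pullback_is_linear phi : linear (pullback phi).
Proof. by move=> a f g; apply: val_inj. Qed.
HB.instance Definition _ phi :=
  GRing.isLinear.Build R (smoothFun V) (smoothFun V) _ (pullback phi)
    (pullback_is_linear phi).

Lemma tangent_map_leibniz (phi : smoothMap) X (f g : smoothFun V) :
  (X \o pullback phi) (f * g) =
  (X \o pullback phi) f * g (phi (foot X)) +
  f (phi (foot X)) * (X \o pullback phi) g.
Proof.
have -> : (X \o pullback phi) (f * g) = X (pullback phi f * pullback phi g).
  by congr (deriv_of _ _); apply: val_inj.
exact: leibniz.
Qed.

(* (T phi) X acts on functions by f |-> X (f \o phi). *)
Definition tangent_map (phi : smoothMap) X : tangentBundle V :=
  TangentVector (deriv_of := (X : {scalar smoothFun V}) \o pullback phi)
    (tangent_map_leibniz phi X).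

Lemma affine_smooth (a : R) (x : V) (f : smoothFun V) :
  (f \o (fun v => a *: v + x)) \in smooth.
Proof.
have /asboolP Cf := smooth_funP f; rewrite smoothE; apply/asboolP => k.
suff -> : (f \o (fun v => a *: v + x)) \o r2v =
          fun v => (f \o r2v) (a *: v + v2r x) by exact: Cdiff_affine.
by apply/funext => v /=; rewrite linearD linearZ /= v2rK.
Qed.

Lemma translation_smooth (x : V) (f : smoothFun V) :
  (f \o (fun v => v + x)) \in smooth.
Proof.
suff -> : (fun v => v + x) = (fun v => 1 *: v + x) by exact: affine_smooth.
by apply/funext => v; rewrite scale1r.
Qed.

Lemma homothety_smooth (a : R) (f : smoothFun V) :
  (f \o (fun v => a *: v)) \in smooth.
Proof.
suff -> : (fun v : V => a *: v) = (fun v => a *: v + 0) by exact: affine_smooth.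
by apply/funext => v; rewrite addr0.
Qed.

Definition tau (x : V) : smoothMap := SmoothMap (translation_smooth x).
Definition sigma (a : R) : smoothMap := SmoothMap (homothety_smooth a).

Lemma fibre_add_leibniz X Y (XY : foot X = foot Y) (f g : smoothFun V) :
  (X \+ Y) (f * g) = (X \+ Y) f * g (foot X) + f (foot X) * (X \+ Y) g.
Proof. by rewrite /= !leibniz XY mulrDl mulrDr addrACA. Qed.

(* Addition in the fibre over the common foot of X and Y. *)
Definition fibre_add X Y (XY : foot X = foot Y) : tangentBundle V :=
  TangentVector
    (deriv_of := (X : {scalar smoothFun V}) \+ (Y : {scalar smoothFun V}))
    (fibre_add_leibniz XY).

Lemma foot_tangent_map_tau X Y :
  foot (tangent_map (tau (foot Y)) X) = foot (tangent_map (tau (foot X)) Y).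
Proof. exact: addrC. Qed.

Definition oplus X Y : tangentBundle V := fibre_add (foot_tangent_map_tau X Y).

Definition bullet (a : R) X : tangentBundle V := tangent_map (sigma a) X.

End TangentMap.

Section Trivialization.
Context {R : realType} {V : vectType R} {n : nat}.
Variable xi : {linear V -> 'rV[R]_n}.

Lemma coordinate_smooth (i : 'I_n) : (fun v => xi v 0 i) \in @smooth R V.
Proof.
rewrite smoothE; apply/asboolP => k.
pose l : 'rV[R]_(dim V) -> R := fun u => xi (r2v u) 0 i.
have l_lin : scalar l by move=> a u v; rewrite /l !linearP !mxE.
pose L := GRing.isLinear.Build R _ _ _ l l_lin.
exact: (Cdiff_linear k (HB.pack l L : {scalar _})).
Qed.

(* The coordinate function x_i = u_i \o xi. *)
Definition coordinate (i : 'I_n) : smoothFun V := SmoothFun (coordinate_smooth i).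

Definition trivialization (X : tangentBundle V) : V * 'rV[R]_n :=
  (foot X, \sum_(i < n) X (coordinate i) *: delta_mx 0 i).

End Trivialization.

(* Main.v *)
Require Import Defs.
From HB Require Import structures.
From mathcomp Require Import all_boot all_order all_algebra.
From mathcomp Require Import all_classical all_reals all_analysis.
From mathcomp Require Import ring.

(* Both operations on TV are carried by psi to those of V x R^n, since
   pulling back a linear coordinate along a translation (resp. a homothety)
   adds a constant (resp. multiplies it by the factor), and derivations kill
   constants.  So once psi is bijective, the vector space axioms on TV follow
   from those of V x R^n.  Surjectivity is given by directional derivatives,
   and injectivity by Hadamard's lemma
     f x = f p + \sum_i (x_i - p_i) g_i x  with g_i smooth,
   which implies X f = \sum_i X(x_i) (g_i p) for a derivation X at p.  Here the
   segment from p to x is replaced by a path along the coordinate axes, so that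
   g_i is the integral over s of the i-th partial derivative of f at
   (x_1, .., x_(i-1), p_i + s (x_i - p_i), p_(i+1), .., p_m),
   and only one-variable chain rules are needed. *)

Set Implicit Arguments.
Unset Strict Implicit.
Unset Printing Implicit Defensive.

Import Order.TTheory GRing.Theory Num.Theory.
Import numFieldNormedType.Exports.
Import VectorInternalTheory.

Local Open Scope classical_set_scope.
Local Open Scope ring_scope.

(** * Integrals over the unit interval depending on a parameter *)

Section ParametricIntegral.
Context {R : realType}.

Lemma continuous2_comp {T U V W : topologicalType} (h : U -> V -> W)
    (f : T -> U) (g : T -> V) :
  continuous (fun z : U * V => h z.1 z.2) -> continuous f -> continuous g ->
  continuous (fun x => h (f x) (g x)).
Proof.
move=> ch cf cg x; apply: (@continuous2_cvg _ _ _ _ _ _ f g h (f x) (g x)).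
- exact: (ch (f x, g x)).
- exact: cf.
- exact: cg.
Qed.

Definition int01 (f : R -> R) : R :=
  \int[lebesgue_measure]_(s in `[0, 1]) f s.

Lemma integrable_int01 (f : R -> R) : continuous f ->
  (@lebesgue_measure R).-integrable `[0, 1] (EFin \o f).
Proof.
move=> cf; apply: continuous_compact_integrable; first exact: segment_compact.
exact: continuous_subspaceT.
Qed.

Lemma int01_cst (c : R) : int01 (cst c) = c.
Proof.
rewrite /int01 Rintegral_cst//= lebesgue_measure_itv/= lte_fin ltr01.
by rewrite oppr0 adde0 mulr1.
Qed.

Lemma int01Z (a : R) (f : R -> R) : continuous f ->
  int01 (fun s => a * f s) = a * int01 f.
Proof. by move=> cf; rewrite /int01 RintegralZl//; exact: integrable_int01. Qed.

Lemma int01_derive (F f : R -> R) : continuous f ->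
  (forall s, is_derive s (1 : R) F (f s)) -> int01 f = F 1 - F 0.
Proof.
move=> cf dF; rewrite /int01 /Rintegral (@continuous_FTC2 _ f F)//.
- exact: continuous_subspaceT.
- have cF : continuous F.
    move=> s; apply/differentiable_continuous/derivable1_diffP.
    by case: (dF s).
  split=> [s _||]; first by case: (dF s).
  - by apply: cvg_at_right_filter; exact: cF.
  - by apply: cvg_at_left_filter; exact: cF.
- by move=> s _; rewrite derive1E; case: (dF s).
Qed.

(** Compactness of [[0, 1]] makes the continuity of [h s] at [x] uniform in [s]. The integrands then
    differ by at most [e], and so do the integrals, since the interval has measure 1. *)
Lemma int01_cvg {U : topologicalType} (h : R -> U -> R) :
  continuous (fun z : R * U => h z.1 z.2) ->
  continuous (fun x => int01 (h^~ x)).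
Proof.
move=> ch x.
have chx y : continuous (h^~ y).
  apply: (continuous2_comp (f := id) (g := cst y) ch) => s.
    exact: cvg_id.
  exact: cst_continuous.
apply/cvgrPdist_le => e e0.
have : \forall y \near x, `[0%R, 1%R] `<=` [set s : R | `|h s x - h s y| <= e].
  have /compact_near_coveringP := @segment_compact R 0 1; apply => s _.
  (* Half of [e], because [h s' x] and [h s' y] are both compared with [h s x]. *)
  have e20 : 0 < e / 2 by rewrite divr_gt0.
  have /cvgrPdist_le/(_ _ e20) := ch (s, x).
  case=> -[A B] /= [As Bx] AB; exists (A, B); first by [].
  move=> -[s' y] /= [As' By].
  have h1 := AB (s', y) (conj As' By).
  have h2 := AB (s', x) (conj As' (nbhs_singleton Bx)).
  rewrite /= in h1 h2; rewrite (splitr e) (le_trans (ler_distD (h s x) _ _))//.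
  by rewrite lerD// distrC.
apply: filterS => y hy.
have ci : continuous (fun s => h s x - h s y).
  by move=> s; apply: cvgB; exact: chx.
rewrite /int01 -RintegralB//; [|exact: integrable_int01..].
rewrite (le_trans (le_normr_Rintegral _ _))//; first exact: integrable_int01.
rewrite -[leRHS]int01_cst /int01; apply: le_Rintegral => //.
- apply: (@integrable_int01 (fun s => `|h s x - h s y|)) => s.
  by apply: cvg_norm; exact: ci.
- by apply: integrable_int01 => s; exact: cst_continuous.
Qed.

(** Restriction to the line [t *: v + x] reduces this to differentiation under the integral in the
    real variable [t] at 0. The dominating constant comes from the continuity of [h'] on a compact
    rectangle. *)
Lemma int01_is_derive {U : normedModType R} (v x : U) (h h' : R -> U -> R) :
  continuous (fun z : R * U => h z.1 z.2) ->
  continuous (fun z : R * U => h' z.1 z.2) ->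
  (forall s y, is_derive y v (h s) (h' s y)) ->
  is_derive x v (fun y => int01 (h^~ y)) (int01 (h'^~ x)).
Proof.
move=> ch ch' dh.
have chx y : continuous (h^~ y).
  apply: (continuous2_comp (f := id) (g := cst y) ch) => s.
    exact: cvg_id.
  exact: cst_continuous.
pose f (t s : R) := h s (t *: v + x).
have df t s : is_derive t (1 : R) (f^~ s) (h' s (t *: v + x)).
  have [d1 d2] := dh s (t *: v + x).
  have e : (fun k : R => k^-1 *: ((f^~ s \o shift t) (k *: 1) - f t s)) =
     (fun k : R => k^-1 *: ((h s \o shift (t *: v + x)) (k *: v) -
       h s (t *: v + x))).
    apply/funext => k /=; rewrite /f.
    by rewrite [k *: 1]mulr1 scalerDl addrA.
  by split; rewrite /derivable /derive e.
have cf' : continuous (fun z : R * R => h' z.1 (z.2 *: v + x)).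
  apply: (continuous2_comp (T := (R * R)%type) (f := fst)
    (g := fun z => z.2 *: v + x) ch') => z.
    exact: cvg_fst.
  by apply: cvgD; [apply: cvgZr_tmp; exact: cvg_snd|exact: cvg_cst].
have [M Mub] : exists M : R, forall t s, `]-1, 1[%classic t ->
    `[0, 1]%classic s ->
    `|h' s (t *: v + x)| <= M.
  have cK : compact (`[0, 1]%classic `*` `[-1, 1]%classic : set (R * R)).
    by apply: compact_setX; exact: segment_compact.
  have := continuous_compact (continuous_subspaceT cf') cK.
  (* Boundedness only provides the numbers strictly above [M] as bounds, hence [M + 1]. *)
  move=> /compact_bounded[M [_ HM]]; exists (M + 1) => t s t1 s1.
  apply: (HM (M + 1)); first by rewrite ltrDl.
  exists (s, t) => //; split => //=.
  by apply: subset_itv_oo_cc.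
have I0 : `]-1, 1[%classic (0 : R) by rewrite /= in_itv/= ltrN10 ltr01.
have intf t : `]-1, 1[%classic t ->
    (@lebesgue_measure R).-integrable `[0, 1] (EFin \o f t).
  by move=> _; exact: (integrable_int01 (chx _)).
(* The dominating function has to be nonnegative everywhere. *)
have M0 : 0 <= Num.max M 0 by rewrite le_max lexx orbT.
have intM : (@lebesgue_measure R).-integrable `[0, 1]
    (EFin \o (fun _ : R => Num.max M 0)).
  by apply: integrable_int01 => s; exact: cst_continuous.
have df' t s : `]-1, 1[%classic t -> `[0, 1]%classic s -> derivable (f^~ s) t 1.
  by move=> _ _; case: (df t s).
have ub t s : `]-1, 1[%classic t -> `[0, 1]%classic s ->
    `|partial1of2 f t s| <= Num.max M 0.
  move=> t1 s1; rewrite partial1of2E; have [_ ->] := df t s.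
  by rewrite le_max Mub.
have mI : measurable (`[0, 1]%classic : set (measurableTypeR R)) by [].
have D := derivable_under_integral mI I0 intf df' (fun=> M0) intM ub.
have E := differentiation_under_integral mI I0 intf df' (fun=> M0) intM ub.
have {}E : derive1 (fun t => int01 (f t)) 0 = int01 (h'^~ x).
  rewrite [LHS]E; congr Rintegral; apply/funext => s.
  rewrite partial1of2E; have [_ ->] := df 0 s.
  by rewrite scale0r add0r.
split.
  by apply/derivable1P; exact: D.
rewrite -E derive1E.
have e : (fun k : R => k^-1 *: (((fun t => int01 (f t)) \o shift 0) (k *: 1) -
    int01 (f 0))) =
  (fun k : R => k^-1 *: (((fun y => int01 (h^~ y)) \o shift x) (k *: v) -
    int01 (h^~ x))).
  by apply/funext => k /=; rewrite addr0 [k *: 1]mulr1 /f scale0r add0r.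
by rewrite /derive e.
Qed.
End ParametricIntegral.

(** * Hadamard's lemma along a path parallel to the axes *)

Section Hadamard.
Context {R : realType} {m : nat}.
Implicit Types (f : 'rV[R]_m -> R) (p x : 'rV[R]_m) (i j : 'I_m).

(** A homothety centred at [p] with a separate ratio for each coordinate. Ratios 0 and 1 select the
    coordinates of [p] and of [x], so one formula covers all points of the path. *)
Definition stretch p (a : 'I_m -> R) x : 'rV[R]_m :=
  \row_l (p 0 l + a l * (x 0 l - p 0 l)).

Lemma stretch_id p (a : 'I_m -> R) : stretch p a p = p.
Proof. by apply/rowP => l; rewrite mxE subrr mulr0 addr0. Qed.

Lemma stretch0 p x : stretch p (fun=> 0) x = p.
Proof. by apply/rowP => l; rewrite mxE mul0r addr0. Qed.

Lemma stretch1 p x : stretch p (fun=> 1) x = x.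
Proof. by apply/rowP => l; rewrite mxE mul1r addrC subrK. Qed.

Lemma stretch_delta p (a : 'I_m -> R) x (t : R) j :
  stretch p a (t *: delta_mx 0 j + x) =
  a j *: (t *: delta_mx 0 j) + stretch p a x.
Proof.
apply/rowP => l; rewrite !mxE eqxx /=; have [->|_] := eqVneq l j.
  by rewrite !mulr1; ring.
by rewrite /= !mulr0 !add0r.
Qed.

Lemma stretch_continuous p (w : R -> 'I_m -> R) :
  (forall l, continuous (w^~ l)) ->
  continuous (fun z : R * 'rV[R]_m => stretch p (w z.1) z.2).
Proof.
move=> cw.
(* Expanding in the standard basis reduces continuity to that of scalar coordinates. *)
have -> : (fun z : R * 'rV[R]_m => stretch p (w z.1) z.2) =
    fun z => \sum_l (p 0 l + w z.1 l * (z.2 0 l - p 0 l)) *: delta_mx 0 l.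
  apply/funext => z; rewrite [LHS]row_sum_delta.
  by apply: eq_bigr => l _; rewrite mxE.
apply: continuous_big => [|l _ z].
  exact: add_continuous.
apply: cvgZr_tmp.
apply: cvgD; first exact: cvg_cst.
apply: cvgM.
  by apply: (@continuous_comp _ _ _ fst (w^~ l)); [exact: cvg_fst|exact: cw].
apply: cvgB; last exact: cvg_cst.
apply: (@continuous_comp _ _ _ snd (fun x : 'rV[R]_m => x 0 l)).
  exact: cvg_snd.
exact: coord_continuous.
Qed.

(** On the line through [x] in direction [j], [stretch p a] agrees with the affine map of ratio
    [a j] taking the same value at [x]. *)
Lemma is_derive_stretch f p (a : 'I_m -> R) x j :
  derivable f (stretch p a x) (delta_mx 0 j) ->
  is_derive x (delta_mx 0 j) (fun y => f (stretch p a y))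
    (a j * 'D_(delta_mx 0 j) f (stretch p a x)).
Proof.
pose b := stretch p a x - a j *: x.
have bE : a j *: x + b = stretch p a x by rewrite addrC subrK.
rewrite -bE => /is_derive_affine [d1 d2].
have e : (fun h : R => h^-1 *: (((fun y => f (a j *: y + b)) \o shift x)
      (h *: delta_mx 0 j) - f (a j *: x + b))) =
    (fun h : R => h^-1 *: (((fun y => f (stretch p a y)) \o shift x)
      (h *: delta_mx 0 j) - f (stretch p a x))).
  apply/funext => h /=.
  by rewrite [_ *: (_ + x)]scalerDr -addrA bE stretch_delta.
by move: d1 d2; rewrite /derivable /derive e; split.
Qed.

(* The weight c is needed for the induction: differentiating in direction j
   multiplies it by w^~ j. *)
Lemma Cdiff_int01 k f p (w : R -> 'I_m -> R) (c : R -> R) :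
  (forall l, continuous (w^~ l)) -> continuous c -> Cdiff k f ->
  Cdiff k (fun x => int01 (fun s => c s * f (stretch p (w s) x))).
Proof.
move=> cw.
pose G (b : R -> R) (g : 'rV[R]_m -> R) s x := b s * g (stretch p (w s) x).
have cG b g : continuous b -> continuous g ->
    continuous (fun z : R * 'rV[R]_m => G b g z.1 z.2).
  move=> cb cg z; apply: cvgM.
    by apply: (@continuous_comp _ _ _ fst b); [exact: cvg_fst|exact: cb].
  apply: (@continuous_comp _ _ _ (fun z => stretch p (w z.1) z.2) g).
    exact: stretch_continuous.
  exact: cg.
elim: k f c => [|k IHk] f c cc [cf Hf].
  by split=> //; apply: (int01_cvg (h := G c f)); exact: cG.
split; first by apply: (int01_cvg (h := G c f)); exact: cG.
move=> j; have [df Cdf] := Hf j.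
pose cj s := c s * w s j.
have ccj : continuous cj by move=> s; apply: cvgM; [exact: cc|exact: cw].
have dint x := @int01_is_derive _ _ (delta_mx 0 j) x (G c f)
  (G cj ('D_(delta_mx 0 j) f)) (cG c f cc cf)
  (cG cj _ ccj (Cdiff_cont Cdf)).
have {}dint x : is_derive x (delta_mx 0 j)
    (fun x => int01 (fun s => c s * f (stretch p (w s) x)))
    (int01 (fun s => c s * w s j * 'D_(delta_mx 0 j) f (stretch p (w s) x))).
  apply: dint => s y; rewrite /G /cj -mulrA.
  have := is_derive_stretch (df (stretch p (w s) y)).
  by move=> /(is_deriveZ (c s)).
split=> [x|]; first by case: (dint x).
have -> : 'D_(delta_mx 0 j)
    (fun x => int01 (fun s => c s * f (stretch p (w s) x))) =
  fun x => int01 (fun s => c s * w s j *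
    'D_(delta_mx 0 j) f (stretch p (w s) x)).
  by apply/funext => x; case: (dint x).
exact: (IHk _ _ ccj Cdf).
Qed.

(** For [s] from 0 to 1 these ratios describe the [i]-th edge of the path: earlier coordinates have
    reached [x], later ones are still those of [p]. *)
Definition hadamard_weight i (s : R) (l : 'I_m) : R :=
  if (l < i)%N then 1 else if l == i then s else 0.

Definition hadamard_quotient f p i x : R :=
  int01 (fun s => 'D_(delta_mx 0 i) f (stretch p (hadamard_weight i s) x)).

Lemma hadamard_weight_continuous i l : continuous ((hadamard_weight i)^~ l).
Proof.
rewrite /hadamard_weight; case: (l < i)%N => s; first exact: cvg_cst.
by case: (l == i); [exact: cvg_id|exact: cvg_cst].
Qed.

Lemma Cdiff_hadamard_quotient k f p i :
  Cdiff k.+1 f -> Cdiff k (hadamard_quotient f p i).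
Proof.
move=> [_ /(_ i)[_ Cf]].
have -> : hadamard_quotient f p i = fun x => int01 (fun s => cst 1 s *
    'D_(delta_mx 0 i) f (stretch p (hadamard_weight i s) x)).
  by apply/funext => x; congr int01; apply/funext => s; rewrite mul1r.
have c1 : continuous (cst 1 : R -> R) by move=> s; exact: cst_continuous.
exact: (Cdiff_int01 p (@hadamard_weight_continuous i) c1 Cf).
Qed.

(** For [x = p] the path is constant, and so is the integrand. *)
Lemma hadamard_quotient_id f p i :
  hadamard_quotient f p i p = 'D_(delta_mx 0 i) f p.
Proof.
rewrite /hadamard_quotient -[RHS]int01_cst; congr int01.
by apply/funext => s; rewrite stretch_id.
Qed.

(** The increment of [f] telescopes over the vertices of the path, and on each edge it is the
    integral of the derivative of [f] along that edge. *)
Lemma hadamard_sum f p x : Cdiff 1 f ->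
  f x - f p = \sum_i (x 0 i - p 0 i) * hadamard_quotient f p i x.
Proof.
move=> [_ Hf].
(* The [k]-th vertex: the first [k] coordinates come from [x], the others from [p]. *)
pose P (k : nat) := stretch p (fun l => (l < k)%N%:R) x.
have -> : f x - f p = \sum_(i < m) (f (P i.+1) - f (P i)).
  rewrite -(big_mkord xpredT (fun k => f (P k.+1) - f (P k))).
  rewrite telescope_sumr// /P; congr (f _ - f _).
    rewrite -[LHS](stretch1 p); congr stretch.
    by apply/funext => l; rewrite ltn_ord.
  by rewrite -[LHS](stretch0 p x).
apply: eq_bigr => i _; have [df [cf' _]] := Hf i.
have cS : continuous (fun s => stretch p (hadamard_weight i s) x).
  have := stretch_continuous (p := p) (@hadamard_weight_continuous i).
  move=> /(continuous2_comp (h := fun s x => stretch p (hadamard_weight i s) x)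
    (f := id) (g := cst x)); apply => s; [exact: cvg_id|exact: cvg_cst].
have cD : continuous (fun s : R =>
    'D_(delta_mx 0 i) f (stretch p (hadamard_weight i s) x)).
  move=> s; apply: (@continuous_comp _ _ _
    (fun s => stretch p (hadamard_weight i s) x) ('D_(delta_mx 0 i) f)).
    exact: cS.
  exact: cf'.
rewrite /hadamard_quotient -int01Z//.
have dF s : is_derive s (1 : R)
    (fun s => f (stretch p (hadamard_weight i s) x))
    ((x 0 i - p 0 i) *
      'D_(delta_mx 0 i) f (stretch p (hadamard_weight i s) x)).
  set y := stretch p (hadamard_weight i s) x.
  set d := x 0 i - p 0 i.
  (* The edge is affine in its parameter. The summand 0 gives the shape of a difference quotient at
     the origin, so that [is_derive_affine] applies there. *)
  have yE (h : R) : stretch p (hadamard_weight i (h + s)) x =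
      d *: (h *: delta_mx 0 i + 0) + y.
    apply/rowP => l; rewrite /y !mxE eqxx /= addr0 /hadamard_weight /d.
    case: (eqVneq l i) => [->|_]; first by rewrite ltnn mulr1; ring.
    by rewrite /= !mulr0 !add0r.
  have y0 : d *: 0 + y = y by rewrite scaler0 add0r.
  have : derivable f (d *: 0 + y) (delta_mx 0 i) by exact: df.
  move=> /is_derive_affine [d1 d2].
  have e : (fun h : R => h^-1 *: (((fun z => f (d *: z + y)) \o shift 0)
        (h *: delta_mx 0 i) - f (d *: 0 + y))) =
      (fun h : R => h^-1 *: (((fun s => f (stretch p (hadamard_weight i s) x))
        \o shift s) (h *: 1) - f y)).
    by apply/funext => h /=; rewrite [h *: 1]mulr1 yE y0.
  by move: d1 d2; rewrite /derivable /derive e y0; split.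
rewrite [RHS](int01_derive _ dF); last first.
  by move=> s; apply: cvgM; [exact: cvg_cst|exact: cD].
(* The ends [s = 1] and [s = 0] of the edge are the vertices [P i.+1] and [P i]. *)
congr (f _ - f _); apply/rowP => l; rewrite !mxE /hadamard_weight -val_eqE /=;
  congr (_ + _ * _).
- by rewrite ltnS; case: ltngtP.
- by case: ltngtP.
Qed.

End Hadamard.

(** Every axiom becomes an identity of [W] after applying the injective map [g]; zero and opposites
    are taken through the inverse [h]. *)
Lemma lmodule_transport (R : pzRingType) (W : lmodType R) (T : Type)
    (add : T -> T -> T) (scale : R -> T -> T) (g : T -> W) :
  bijective g -> {morph g : x y / add x y >-> x + y} ->
  (forall a, {morph g : x / scale a x >-> a *: x}) ->
  exists L : GRing.Lmodule.axioms_ R T,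
  let TL : lmodType R := GRing.Lmodule.Pack L in
  (forall x y : TL, x + y = add x y) /\
  (forall (a : R) (x : TL), a *: x = scale a x).
Proof.
move=> [h hK gK] gD gZ; have g_inj := can_inj hK.
(* A bare type receives its equality test and choice operator from classical logic. *)
pose C : choiceType := HB.pack T (gen_eqMixin T) (gen_choiceMixin T).
have addA : associative (add : C -> C -> C).
  by move=> x y z; apply: g_inj; rewrite !gD addrA.
have addC : commutative (add : C -> C -> C).
  by move=> x y; apply: g_inj; rewrite !gD addrC.
have add0 : left_id (h 0 : C) add.
  by move=> x; apply: g_inj; rewrite gD gK add0r.
have addN : left_inverse (h 0 : C) (fun x => h (- g x)) add.
  by move=> x; apply: g_inj; rewrite gD !gK addNr.
pose Z : zmodType := HB.pack C (GRing.isZmodule.Build C addA addC add0 addN).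
have scaleA a b (x : Z) : scale a (scale b x) = scale (a * b) x.
  by apply: g_inj; rewrite !gZ scalerA.
have scale1 : left_id 1 (scale : R -> Z -> Z).
  by move=> x; apply: g_inj; rewrite gZ scale1r.
have scaleDr : right_distributive (scale : R -> Z -> Z) +%R.
  by move=> a x y; apply: g_inj; rewrite gZ !gD !gZ scalerDr.
have scaleDl (x : Z) : {morph (scale^~ x : R -> Z) : a b / a + b}.
  by move=> a b; apply: g_inj; rewrite gD !gZ scalerDl.
pose L : lmodType R := HB.pack Z
  (GRing.Zmodule_isLmodule.Build R Z scaleA scale1 scaleDr scaleDl).
by exists (GRing.Lmodule.class L).
Qed.

Lemma derive_scalar (R : realType) m (l : {scalar 'rV[R]_m}) (x v : 'rV[R]_m) :
  'D_v l x = l v.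
Proof.
have cl : continuous l := Cdiff_cont (Cdiff_linear 0 l).
by rewrite deriveE ?diff_lin//; exact: linear_differentiable.
Qed.

(** * Derivations at a point as directional derivatives *)

Section Derivations.
Context {R : realType} {V : vectType R}.
Implicit Types (f g : smoothFun V) (X Y : tangentBundle V) (p : V).

Lemma smoothFunP f g : (forall v, f v = g v) -> f = g.
Proof. by move=> fg; apply/val_inj/funext. Qed.

Lemma smoothFun_sum (I : finType) (F : I -> smoothFun V) (v : V) :
  (\sum_i F i) v = \sum_i F i v.
Proof. exact: (big_morph (fun f : smoothFun V => f v)). Qed.

(** Proof irrelevance identifies the proofs of linearity and of the Leibniz rule; the feet are
    unified first because the latter depends on them. *)
Lemma tangentBundleP X Y : foot X = foot Y -> (forall f, X f = Y f) -> X = Y.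
Proof.
case: X Y => [p D LD] [q E LE] /= pq DE; case: _ / pq in LE *.
have {}DE : D = E.
  case: D E DE {LD LE} => [D [[D1] [D2]]] [E [[E1] [E2]]] /= DE.
  have {}DE : D = E by exact/funext.
  case: _ / DE in E1 E2 *.
  by rewrite (Prop_irrelevance D1 E1) (Prop_irrelevance D2 E2).
by case: _ / DE in LE *; rewrite (Prop_irrelevance LD LE).
Qed.

Definition constant (c : R) : smoothFun V := SmoothFun (smooth_cst c).

(** The Leibniz rule for [1 * 1 = 1] gives [X 1 = X 1 + X 1]; linearity does the rest. *)
Lemma derivation_constant X (c : R) : X (constant c) = 0.
Proof.
have -> : constant c = c *: constant 1.
  by apply: smoothFunP => v; rewrite [RHS]mulr1.
have c1M : constant 1 * constant 1 = constant 1.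
  by apply: smoothFunP => v; rewrite [LHS]mulr1.
rewrite linearZ /=; have /eqP := leibniz X (constant 1) (constant 1).
rewrite c1M /= mulr1 mul1r -subr_eq0 opprD addNKr oppr_eq0 => /eqP ->.
by rewrite mulr0.
Qed.

Definition chart (j : 'I_(dim V)) : smoothFun V := coordinate v2r j.

Lemma smooth_chart f k : Cdiff k (f \o r2v).
Proof. by have /asboolP := smooth_funP f. Qed.

Lemma hadamard_quotient_smooth f p j :
  (fun v => hadamard_quotient (f \o r2v) (v2r p) j (v2r v)) \in @smooth R V.
Proof.
rewrite smoothE; apply/asboolP => k.
have -> : (fun v => hadamard_quotient (f \o r2v) (v2r p) j (v2r v)) \o r2v =
    hadamard_quotient (f \o r2v) (v2r p) j.
  by apply/funext => u /=; rewrite r2vK.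
exact/Cdiff_hadamard_quotient/smooth_chart.
Qed.

Lemma hadamard f p :
  f = constant (f p) + \sum_j (chart j - constant (v2r p 0 j)) *
    SmoothFun (hadamard_quotient_smooth f p j).
Proof.
apply: smoothFunP => v.
have := hadamard_sum (v2r p) (v2r v) (smooth_chart f 1).
rewrite /= !v2rK => /eqP; rewrite subr_eq => /eqP ->; rewrite addrC.
by rewrite [RHS]/(_ + _) smoothFun_sum.
Qed.

(** In Hadamard's decomposition at the foot, [X] kills the constants, and the factor
    [chart j - constant _] vanishes at the foot. Only its derivative times the quotient at the foot
    survives, and that value is the partial derivative. *)
Lemma derivation_chart X f :
  X f = \sum_j X (chart j) * 'D_(delta_mx 0 j) (f \o r2v) (v2r (foot X)).
Proof.
rewrite [in LHS](hadamard f (foot X)) linearD derivation_constant add0r.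
rewrite linear_sum; apply: eq_bigr => j _; rewrite leibniz linearB /= derivation_constant subr0.
rewrite hadamard_quotient_id.
rewrite [X in _ + X * _](_ : _ = 0) ?mul0r ?addr0//.
by rewrite [LHS]subrr.
Qed.

Lemma smooth_derivable f (u : 'rV[R]_(dim V)) j :
  derivable (f \o r2v) u (delta_mx 0 j).
Proof. by have [_ /(_ j)[]] := smooth_chart f 1. Qed.

(** The direction [b] is given in the coordinates of [v2r], not in those of [xi]. *)
Definition directional_derivative p (b : 'rV[R]_(dim V)) f : R :=
  \sum_j b 0 j * 'D_(delta_mx 0 j) (f \o r2v) (v2r p).

Lemma directional_derivative_linear p b : scalar (directional_derivative p b).
Proof.
move=> a f g; rewrite /directional_derivative mulr_sumr -big_split /=.
apply: eq_bigr => j _.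
have -> : (a *: f + g) \o r2v = a *: (f \o r2v) + (g \o r2v) by [].
have df := @smooth_derivable f (v2r p) j.
have dg := @smooth_derivable g (v2r p) j.
rewrite deriveD//; last exact: derivableZ.
by rewrite deriveZ// mulrDr [b 0 j * (_ *: _)]mulrCA.
Qed.
HB.instance Definition _ p b := GRing.isLinear.Build R (smoothFun V) R _
  (directional_derivative p b) (directional_derivative_linear p b).

Lemma directional_derivative_leibniz p b f g :
  directional_derivative p b (f * g) =
  directional_derivative p b f * g p + f p * directional_derivative p b g.
Proof.
rewrite /directional_derivative mulr_suml mulr_sumr -big_split /=.
apply: eq_bigr => j _.
have -> : (f * g) \o r2v = (f \o r2v) * (g \o r2v) by [].
have df := @smooth_derivable f (v2r p) j.
have dg := @smooth_derivable g (v2r p) j.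
rewrite deriveM//= v2rK /GRing.scale /=; ring.
Qed.

Definition directional_vector p b : tangentBundle V :=
  TangentVector (deriv_of := directional_derivative p b)
    (directional_derivative_leibniz p b).

End Derivations.

(** * Linearity and bijectivity of the trivialization *)

Section TrivializationIso.
Context {R : realType} {V : vectType R} {n : nat}.
Variable xi : {linear V -> 'rV[R]_n}.
Implicit Types X Y : tangentBundle V.

Lemma trivialization_snd X i :
  (trivialization xi X).2 0 i = X (coordinate xi i).
Proof.
rewrite /= summxE (bigD1 i)//= big1 => [|j ji]; rewrite !mxE eqxx /=.
  by rewrite eqxx mulr1 addr0.
by rewrite eq_sym (negbTE ji) mulr0.
Qed.

Lemma trivialization_eqP X (w : V * 'rV[R]_n) : foot X = w.1 ->
  (forall i, X (coordinate xi i) = w.2 0 i) -> trivialization xi X = w.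
Proof.
case: w => p c /= Xp Xc; rewrite [LHS]surjective_pairing; congr pair => //.
by apply/rowP => i; rewrite trivialization_snd.
Qed.

Lemma trivialization_oplus :
  {morph trivialization xi : X Y / oplus X Y >-> X + Y}.
Proof.
move=> X Y; apply: trivialization_eqP => // i; rewrite mxE !trivialization_snd.
have pullE y : pullback (tau y) (coordinate xi i) =
    coordinate xi i + constant (xi y 0 i).
  by apply: smoothFunP => v /=; rewrite linearD mxE.
rewrite [LHS]/(X (pullback _ _) + Y (pullback _ _)) !pullE !linearD.
by rewrite !derivation_constant !addr0.
Qed.

Lemma trivialization_bullet (a : R) :
  {morph trivialization xi : X / bullet a X >-> a *: X}.
Proof.
move=> X; apply: trivialization_eqP => // i; rewrite mxE !trivialization_snd.
have pullE : pullback (sigma a) (coordinate xi i) = a *: coordinate xi i.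
  by apply: smoothFunP => v /=; rewrite linearZ mxE.
have XZ : X (a *: coordinate xi i) = a * X (coordinate xi i).
  by rewrite linearZ.
by rewrite -XZ -pullE.
Qed.

(** Read through [r2v], the coordinate is a linear form, whose derivative in any direction is its
    value on that direction. *)
Lemma directional_vector_coordinate p b i :
  directional_vector p b (coordinate xi i) = xi (r2v b) 0 i.
Proof.
pose l (u : 'rV[R]_(dim V)) : R := xi (r2v u) 0 i.
have l_lin : scalar l by move=> a u v; rewrite /l !linearP !mxE.
pose L := GRing.isLinear.Build R _ _ _ l l_lin.
pose ll : {scalar 'rV[R]_(dim V)} := HB.pack l L.
rewrite -[RHS]/(ll b) [in RHS](row_sum_delta b) linear_sum.
apply: eq_bigr => j _; rewrite linearZ; congr (_ * _).
exact: (derive_scalar ll).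
Qed.

(** The inverse differentiates at [w.1] in the direction [eta w.2]. It is a left inverse because the
    functions [chart j] are linear combinations of the coordinates of [xi], so their derivatives
    under [X] can be recovered. *)
Lemma trivialization_bij : bijective xi -> bijective (trivialization xi).
Proof.
move=> [eta xiK etaK].
exists (fun w => directional_vector w.1 (v2r (eta w.2)))
  => [X|[p c]]; last first.
  apply: trivialization_eqP => // i.
  by rewrite directional_vector_coordinate v2rK etaK.
apply: tangentBundleP => //= f; rewrite [RHS]derivation_chart.
apply: eq_bigr => j _; congr (_ * _).
pose etaL : {linear 'rV[R]_n -> V} :=
  HB.pack eta (GRing.isLinear.Build R _ _ _ eta (can2_linear xiK etaK)).
(* The coefficients form the change of basis matrix from [xi] to [v2r]. *)
have chartE : chart j =
    \sum_i v2r (eta (delta_mx 0 i)) 0 j *: coordinate xi i.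
  apply: smoothFunP => v; rewrite -[LHS]/(v2r v 0 j) -[in LHS](xiK v).
  rewrite [xi v]row_sum_delta -[eta]/(etaL : _ -> _) !linear_sum summxE.
  rewrite smoothFun_sum.
  by apply: eq_bigr => i _; rewrite !linearZ mxE mulrC.
rewrite chartE -[eta]/(etaL : _ -> _) !linear_sum summxE.
by apply: eq_bigr => i _; rewrite !linearZ mxE mulrC.
Qed.

End TrivializationIso.

Theorem proposition3p2 (R : realType) (n : nat) (V : vectType R)
    (dimV : \dim {:V} = n)
    (xi : {linear V -> 'rV[R]_n}) (xi_bij : bijective xi) :
  exists TV_lmod : GRing.Lmodule.axioms_ R (tangentBundle V),
  let TV : lmodType R := GRing.Lmodule.Pack TV_lmod in
  [/\ forall X Y : TV, X + Y = oplus X Y,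
      forall (a : R) (X : TV), a *: X = bullet a X,
      linear (trivialization xi : TV -> (V * 'rV[R]_n)%type)
    & bijective (trivialization xi)].
Proof.
have bij := trivialization_bij xi_bij.
have [L [addE scaleE]] := lmodule_transport bij (trivialization_oplus xi)
  (trivialization_bullet xi).
exists L; split=> // a X Y.
by rewrite addE scaleE trivialization_oplus trivialization_bullet.
Qed.
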